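(* Assume $0<\theta<1$ and let $\varepsilon>0$ with $1/\varepsilon>r\bar x+y_2$. Let $(V^{(k)})_{k\ge0}$ be the sequence of grid functions generated by the upward Howard-Tarski-Kantorovich algorithm described in the context. Then $V^{(k)}$ converges, as $k\to\infty$, to the minimal solution $\underline V^{\varepsilon}$ of the regularized discrete HJB system (R).
   Context: Parameters: $\gamma>1$, $0<\psi<1$, $\rho>r>0$, $y_2>y_1>0$, $\lambda_1,\lambda_2>0$, and $\underline x$ with $\rho\underline x+y_1>0$. Set $\theta=\frac{1-\psi^{-1}}{1-\gamma}>0$, $b=\rho\left[\frac{r+\psi(\rho-r)}{\rho}\right]^{\frac1{1-\psi}}$, and $\bar\jmath=3-j$ for $j\in\{1,2\}$. For $c>0$, $v<0$: $\mathcal F(c,v)=\frac{\rho}{1-\psi^{-1}}\,c^{1-\psi^{-1}}\,((1-\gamma)v)^{1-\theta}$. Grid: $\underline x\le 0<\bar x$, $I\ge 1$ an integer, $\Delta x=(\bar x-\underline x)/I$, $x_i=\underline x+i\Delta x$ for $0\le i\le I$. A grid function is $V=(V_{i,j})_{0\le i\le I,\,j\in\{1,2\}}$; $U\preceq V$ means $U_{i,j}\le V_{i,j}$ for all $i,j$. $\Delta^+V_{i,j}=(V_{i+1,j}-V_{i,j})/\Delta x$ for $i<I$, $\Delta^-V_{i,j}=(V_{i,j}-V_{i-1,j})/\Delta x$ for $i>0$ (the values of $\Delta^+V_{I,j}$, $\Delta^-V_{0,j}$ are arbitrary and play no role). Put $\bar c_j(x)=rx+y_j$, $(z)_+=\max(z,0)$,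 $0^{-\psi}=+\infty$. Regularized Hamiltonian: for $v<0$ and reals $p^F,p^B$ let $c^F=\min\{\rho^\psi(p^F)_+^{-\psi}((1-\gamma)v)^{\frac{1-\gamma\psi}{1-\gamma}},\bar c_j(x_i)\}$ for $i<I$, $c^F=\bar c_j(\bar x)$ for $i=I$; $c^B=\max\{\min\{1/\varepsilon,\rho^\psi(p^B)_+^{-\psi}((1-\gamma)v)^{\frac{1-\gamma\psi}{1-\gamma}}\},\bar c_j(x_i)\}$ for $i>0$, $c^B=\bar c_j(\underline x)$ for $i=0$; and $$\boldsymbol H_\varepsilon(x_i,y_j,v,p^F,p^B)=(\bar c_j(x_i)-c^F)p^F+(\bar c_j(x_i)-c^B)p^B+\mathcal F(c^F,v)+\mathcal F(c^B,v)-\mathcal F(\bar c_j(x_i),v).$$ Barriers: $\check U_{i,1}=\check U_{i,2}=\frac{(rx_i+y_1)^{1-\gamma}}{1-\gamma}$, $\check V_{i,1}=\check V_{i,2}=\frac{(b(x_i+y_2/r))^{1-\gamma}}{1-\gamma}$. System (R): $\frac\rho\theta V_{i,j}=\boldsymbol H_\varepsilon(x_i,y_j,V_{i,j},\Delta^+V_{i,j},\Delta^-V_{i,j})+\lambda_j(V_{i,\bar\jmath}-V_{i,j})$ for all $0\le i\le I$, $j\in\{1,2\}$. A solution of (R) is a grid function $V^\varepsilon$ satisfying these equations and $\check U\preceq V^\varepsilon\preceq\check V$. The minimal solution $\underline V^\varepsilon$ is a solution such that $\underline V^\varepsilon\preceq V^\varepsilon$ for every solution $V^\varepsilon$. Algorithm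 (run without stopping tests). Set $V^{(0)}=\check U$. Given $V^{(k)}$, $V^{(k+1)}$ is the solution of $$\frac\rho\theta V^{(k+1)}_{i,j}=\boldsymbol H_\varepsilon(x_i,y_j,V^{(k)}_{i,j},\Delta^+V^{(k+1)}_{i,j},\Delta^-V^{(k+1)}_{i,j})+\lambda_j(V^{(k+1)}_{i,\bar\jmath}-V^{(k+1)}_{i,j})\quad\forall i,j,$$ computed as the limit as $n\to\infty$ of the inner Howard iterates $V^{(k,n)}$: $V^{(k,0)}=V^{(k)}$; given $V^{(k,n)}$, let $c^{F,(k,n+1)}_{i,j}=\min\{\rho^\psi(\Delta^+V^{(k,n)}_{i,j})_+^{-\psi}((1-\gamma)V^{(k)}_{i,j})^{\frac{1-\gamma\psi}{1-\gamma}},\bar c_j(x_i)\}$ for $i<I$, $c^{F,(k,n+1)}_{I,j}=\bar c_j(\bar x)$; $c^{B,(k,n+1)}_{i,j}=\max\{\min\{1/\varepsilon,\rho^\psi(\Delta^-V^{(k,n)}_{i,j})_+^{-\psi}((1-\gamma)V^{(k)}_{i,j})^{\frac{1-\gamma\psi}{1-\gamma}}\},\bar c_j(x_i)\}$ for $i>0$, $c^{B,(k,n+1)}_{0,j}=\bar c_j(\underline x)$; put $s^{F,(k,n+1)}_{i,j}=\bar c_j(x_i)-c^{F,(k,n+1)}_{i,j}$, $s^{B,(k,n+1)}_{i,j}=\bar c_j(x_i)-c^{B,(k,n+1)}_{i,j}$, and let $V^{(k,n+1)}$ solve the linear system $$\frac\rho\theta V^{(k,n+1)}_{i,j}=s^{F,(k,n+1)}_{i,j}\Delta^+V^{(k,n+1)}_{i,j}+s^{B,(k,n+1)}_{i,j}\Delta^-V^{(k,n+1)}_{i,j}+\mathcal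 F(c^{F,(k,n+1)}_{i,j},V^{(k)}_{i,j})+\mathcal F(c^{B,(k,n+1)}_{i,j},V^{(k)}_{i,j})-\mathcal F(\bar c_j(x_i),V^{(k)}_{i,j})+\lambda_j(V^{(k,n+1)}_{i,\bar\jmath}-V^{(k,n+1)}_{i,j}).$$ *)

(* Defs.v *)
From mathcomp Require Import all_boot all_order all_algebra.
From mathcomp Require Import all_classical all_reals all_analysis.
Set Implicit Arguments.
Unset Strict Implicit.
Unset Printing Implicit Defensive.
Import Order.TTheory GRing.Theory Num.Theory.
Import numFieldNormedType.Exports.
Local Open Scope classical_set_scope.
Local Open Scope ring_scope.

(* [nI] is the number I of grid cells and [xlo], [xhi] are the end points of
   the grid.  Income states are indexed by 'I_2: [ord0] is state 1 and
   [ord_max] is state 2, so that [rev_ord j] is the other state 3 - j. *)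
Record params (R : realType) := Params {
  gamma : R; psi : R; rho : R; r : R;
  y1 : R; y2 : R; lambda1 : R; lambda2 : R;
  xlo : R; xhi : R; nI : nat; eps : R }.

Section Scheme.
Variables (R : realType) (P : params R).

Local Notation gamma := (gamma P).
Local Notation psi := (psi P).
Local Notation rho := (rho P).
Local Notation r := (r P).
Local Notation eps := (eps P).
Local Notation node := 'I_(nI P).+1.
Local Notation grid := 'M[R]_((nI P).+1, 2).

Definition theta : R := (1 - psi^-1) / (1 - gamma).

Definition bcoef : R :=
  rho * ((r + psi * (rho - r)) / rho) `^ (1 / (1 - psi)).

Definition y (j : 'I_2) : R := if j == ord0 then y1 P else y2 P.
Definition lambda (j : 'I_2) : R := if j == ord0 then lambda1 P else lambda2 P.

(* Only used for c > 0 and v < 0. *)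
Definition aggregator (c v : R) : R :=
  rho / (1 - psi^-1) * c `^ (1 - psi^-1) * ((1 - gamma) * v) `^ (1 - theta).

Definition dx : R := (xhi P - xlo P) / (nI P)%:R.
Definition x (i : node) : R := xlo P + i%:R * dx.
Definition cbar (i : node) (j : 'I_2) : R := r * x i + y j.

Definition grid_le (U V : grid) : Prop :=
  forall i j, U i j <= V i j.

(* [inord] makes the forward difference at i = I and the backward difference
   at i = 0 junk values; they are always multiplied by 0 below. *)
Definition Dplus (V : grid) (i : node) (j : 'I_2) : R :=
  (V (inord i.+1) j - V i j) / dx.
Definition Dminus (V : grid) (i : node) (j : 'I_2) : R :=
  (V i j - V (inord i.-1) j) / dx.

(* (p)_+ ^ (- psi), with the convention 0 ^ (- psi) = +oo. *)
Definition pos_part_powN (p : R) : \bar R :=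
  let q := Num.max p 0 in if q == 0 then +oo%E else (q `^ (- psi))%:E.

Definition cstar (v p : R) : \bar R :=
  ((rho `^ psi)%:E * pos_part_powN p *
   (((1 - gamma) * v) `^ ((1 - gamma * psi) / (1 - gamma)))%:E)%E.

(* The extrema are taken in \bar R and are finite, so [fine] loses nothing. *)
Definition cF (i : node) (j : 'I_2) (v p : R) : R :=
  if i == ord_max then cbar i j
  else fine (Order.min (cstar v p) (cbar i j)%:E).
Definition cB (i : node) (j : 'I_2) (v p : R) : R :=
  if i == ord0 then cbar i j
  else fine (Order.max (Order.min (1 / eps)%:E (cstar v p)) (cbar i j)%:E).

Definition Heps (i : node) (j : 'I_2) (v pF pB : R) : R :=
  (cbar i j - cF i j v pF) * pF + (cbar i j - cB i j v pB) * pB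
  + aggregator (cF i j v pF) v + aggregator (cB i j v pB) v
  - aggregator (cbar i j) v.

Definition checkU : grid :=
  \matrix_(i, j) ((r * x i + y1 P) `^ (1 - gamma) / (1 - gamma)).
Definition checkV : grid :=
  \matrix_(i, j) ((bcoef * (x i + y2 P / r)) `^ (1 - gamma) / (1 - gamma)).

Definition solution (V : grid) : Prop :=
  [/\ forall i j, rho / theta * V i j =
        Heps i j (V i j) (Dplus V i j) (Dminus V i j)
        + lambda j * (V i (rev_ord j) - V i j),
      grid_le checkU V & grid_le V checkV].

Definition minimal_solution (V : grid) : Prop :=
  solution V /\ forall W, solution W -> grid_le V W.

(* [V] solves the scheme in which the utility argument is frozen at [v]. *)
Definition frozen_system (v V : grid) : Prop :=
  forall i j, rho / theta * V i j =
    Heps i j (v i j) (Dplus V i j) (Dminus V i j)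
    + lambda j * (V i (rev_ord j) - V i j).

(* [W'] solves the linear system whose policy is computed from the
   differences of [W], the utility argument being frozen at [v]. *)
Definition howard_system (v W W' : grid) : Prop :=
  forall i j,
    let cf := cF i j (v i j) (Dplus W i j) in
    let cb := cB i j (v i j) (Dminus W i j) in
    rho / theta * W' i j =
      (cbar i j - cf) * Dplus W' i j + (cbar i j - cb) * Dminus W' i j
      + aggregator cf (v i j) + aggregator cb (v i j)
      - aggregator (cbar i j) (v i j)
      + lambda j * (W' i (rev_ord j) - W' i j).

(* [xget] and [lim] return arbitrary values when there is no solution,
   resp. no limit; existence and uniqueness have to be asserted separately. *)
Definition howard_step (v W : grid) : grid :=
  xget 0 [set W' | howard_system v W W'].

Definition howard (v : grid) (n : nat) : grid :=
  iter n (howard_step v) v.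

Definition HTK (k : nat) : grid :=
  iter k (fun v : grid => lim (howard v @ \oo)) checkU.

End Scheme.

(* Main.v *)
(* With the utility argument frozen at v < 0, the Hamiltonian is a maximum over
   consumption policies of functions that are affine in the differences of V,
   with the signs of a monotone scheme.  A discrete maximum principle then
   gives comparison for each policy, hence solvability of the linear systems,
   monotonicity of Howard's iterates, and uniqueness of the frozen solution.
   For theta < 1 the Hamiltonian increases with v, so the outer iterates, which
   start from the subsolution checkU, increase; they stay below every solution
   and below the supersolution checkV.  The limit is therefore the minimal
   solution. *)
Require Import Defs.
From HB Require Import structures.
From mathcomp Require Import all_boot all_order all_algebra.
From mathcomp Require Import all_classical all_reals all_analysis.
From mathcomp Require Import ring lra.
Set Implicit Arguments.
Unset Strict Implicit.
Unset Printing Implicit Defensive.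
Import Order.TTheory GRing.Theory Num.Theory.
Import numFieldNormedType.Exports.
Local Open Scope classical_set_scope.
Local Open Scope ring_scope.

(** * Bernoulli and tangent inequalities for real powers *)

Lemma powR_neg_bernoulli (R : realType) (a t : R) :
  a < 0 -> 0 < t -> 1 + a * (t - 1) <= t `^ a.
Proof.
move=> a_lt0 t_gt0; rewrite /powR gt_eqF//; apply: le_trans (expR_ge1Dx _).
rewrite lerD2l ler_nM2l//; have := @le_ln1Dx _ (t - 1).
by rewrite (_ : 1 + (t - 1) = t); [apply; lra | ring].
Qed.

Lemma powR_bernoulli (R : realType) (a t : R) :
  1 < a -> 0 < t -> 1 + a * (t - 1) <= t `^ a.
Proof.
move=> a_gt1 t_gt0.
have -> : t `^ a = t * t `^ (a - 1) by rewrite mulr_powRB1//; lra.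
have ln_ge : 1 - t^-1 <= ln t.
  have := @le_ln1Dx _ (t^-1 - 1).
  rewrite (_ : 1 + (t^-1 - 1) = t^-1); last by ring.
  have : 0 < t^-1 by rewrite invr_gt0.
  rewrite lnV ?posrE//; lra.
have h : 1 + (a - 1) * (1 - t^-1) <= t `^ (a - 1).
  rewrite /powR gt_eqF//; apply: le_trans (expR_ge1Dx _).
  by rewrite lerD2l ler_pM2l//; lra.
have -> : 1 + a * (t - 1) = t * (1 + (a - 1) * (1 - t^-1)).
  by field; rewrite gt_eqF.
by rewrite ler_pM2l.
Qed.

Lemma powR_neg_tangent (R : realType) (a s t : R) :
  a < 0 -> 0 < s -> 0 < t -> s `^ a + a * s `^ (a - 1) * (t - s) <= t `^ a.
Proof.
move=> a_lt0 s_gt0 t_gt0.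
have -> : s `^ (a - 1) = s `^ a / s.
  by rewrite powRB ?powRr1// ?ltW// (gt_eqF s_gt0) implybT.
have -> : t `^ a = s `^ a * (t / s) `^ a.
  rewrite -powRM ?ltW ?divr_gt0//; congr (_ `^ _).
  by field; rewrite gt_eqF.
have -> : s `^ a + a * (s `^ a / s) * (t - s) = s `^ a * (1 + a * (t / s - 1)).
  by field; rewrite gt_eqF.
by rewrite ler_pM2l ?powR_gt0// powR_neg_bernoulli// divr_gt0.
Qed.

Lemma powR_neg_anti (R : realType) (a s t : R) :
  a < 0 -> 0 < s -> s <= t -> t `^ a <= s `^ a.
Proof.
move=> a_lt0 s_gt0 st; rewrite /powR !gt_eqF ?(lt_le_trans s_gt0)//.
by rewrite ler_expR ler_nM2l// ler_ln ?posrE// (lt_le_trans s_gt0).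
Qed.

(** * Convergence of powers and matrices, and solvability of linear systems *)

Lemma cvg_powR (R : realType) (a l : R) (u : nat -> R) :
  0 < l -> u @ \oo --> l -> (fun n => u n `^ a) @ \oo --> l `^ a.
Proof.
move=> l_gt0 ul.
apply: (@continuous_cvg nat R R \oo _ u (fun z => z `^ a) l) => //.
apply/differentiable_continuous/derivable1_diffP/derivable_powR.
by rewrite in_itv/= l_gt0.
Qed.

(** There are finitely many entries, so closeness of each one eventually holds for all of them at
    once. *)
Lemma cvg_mx (R : realType) (m n : nat)
    (W : nat -> 'M[R]_(m.+1, n.+1)) (L : 'M[R]_(m.+1, n.+1)) :
  (forall i j, (fun k => W k i j) @ \oo --> L i j) -> W @ \oo --> L.
Proof.
move=> WL; apply/cvg_mx_entourageP => A entA.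
have h : \forall k \near \oo, forall i j, (L i j, W k i j) \in A.
  apply: filter_forall => i; apply: filter_forall => j.
  have /cvg_entourageP/(_ A entA) := WL i j.
  by move=> hA; near=> k; rewrite inE; near: k; exact: hA.
exact: h.
Unshelve. all: by end_near. Qed.

Lemma nondecreasing_mx_cvg (R : realType) (m n : nat)
    (W : nat -> 'M[R]_(m.+1, n.+1)) (Z : 'M[R]_(m.+1, n.+1)) :
    (forall k i j, W k i j <= W k.+1 i j) ->
    (forall k i j, W k i j <= Z i j) ->
  exists L : 'M[R]_(m.+1, n.+1),
    [/\ W @ \oo --> L, forall i j, (fun k => W k i j) @ \oo --> L i j,
        forall k i j, W k i j <= L i j & forall i j, L i j <= Z i j].
Proof.
move=> Wnd WZ.
have nd i j : nondecreasing_seq (fun k => W k i j).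
  by apply/nondecreasing_seqP => k; exact: Wnd.
have cv i j : cvg ((fun k => W k i j) @ \oo).
  apply: nondecreasing_is_cvgn; first exact: nd.
  by exists (Z i j) => _ [k _ <-]; exact: WZ.
pose L : 'M[R]_(m.+1, n.+1) := \matrix_(i, j) lim ((fun k => W k i j) @ \oo).
have WL i j : (fun k => W k i j) @ \oo --> L i j by rewrite mxE; exact: cv.
exists L; split => //; first exact: cvg_mx.
  by move=> k i j; rewrite mxE; exact: nondecreasing_cvgn_le.
move=> i j; rewrite mxE; apply: limr_le => //.
by apply: nearW => k; exact: WZ.
Qed.

Lemma injective_linear_surj (F : fieldType) (m n : nat)
    (f : 'M[F]_(m, n) -> 'M[F]_(m, n)) :
  linear f -> (forall W, f W = 0 -> W = 0) -> forall B, exists W, f W = B.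
Proof.
move=> f_lin f0 B.
pose g : {linear 'M[F]_(m, n) -> 'M[F]_(m, n)} :=
  HB.pack f (GRing.isLinear.Build F 'M[F]_(m, n) 'M[F]_(m, n) *:%R f f_lin).
have ker0 : lker (linfun g) == 0%VS.
  apply/lker0P => U V; rewrite !lfunE => /eqP; rewrite -subr_eq0 -linearB.
  by move=> /eqP /f0 /eqP; rewrite subr_eq0 => /eqP.
exists ((linfun g)^-1%VF B); change (g ((linfun g)^-1%VF B) = B).
by rewrite -(lfunE g) (lker0_lfunVK ker0).
Qed.

Section Howard.
Variables (R : realType) (P : params R).
Hypotheses (gamma_gt1 : 1 < gamma P)
  (psi_gt0 : 0 < psi P) (psi_lt1 : psi P < 1)
  (r_gt0 : 0 < r P) (r_lt_rho : r P < rho P)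
  (y1_gt0 : 0 < y1 P) (y1_lt_y2 : y1 P < y2 P)
  (lambda1_gt0 : 0 < lambda1 P) (lambda2_gt0 : 0 < lambda2 P)
  (xlo_gt : 0 < rho P * xlo P + y1 P)
  (xlo_le0 : xlo P <= 0) (xhi_gt0 : 0 < xhi P)
  (nI_ge1 : (1 <= nI P)%N)
  (theta_gt0 : 0 < theta P) (theta_lt1 : theta P < 1)
  (eps_gt0 : 0 < eps P) (eps_small : r P * xhi P + y2 P < 1 / eps P).

Local Notation gamma := (gamma P).
Local Notation psi := (psi P).
Local Notation rho := (rho P).
Local Notation r := (r P).
Local Notation eps := (eps P).
Local Notation theta := (theta P).
Local Notation dx := (dx P).
Local Notation node := 'I_(nI P).+1.
Local Notation grid := 'M[R]_((nI P).+1, 2).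
Local Notation cbar := (@cbar R P).
Local Notation agg := (aggregator P).

Implicit Types (i : node) (j : 'I_2).

(** * The aggregator and its marginal utility *)

Definition utility_scale (v : R) : R := ((1 - gamma) * v) `^ (1 - theta).

(** The derivative of [aggregator] in consumption. *)
Definition marginal (c v : R) : R := rho * c `^ (- psi^-1) * utility_scale v.

Lemma rho_gt0 : 0 < rho.
Proof. exact: lt_trans r_lt_rho. Qed.

Lemma aggregator_exponent_lt0 : 1 - psi^-1 < 0.
Proof. by rewrite subr_lt0 invf_gt1. Qed.

Lemma utility_scale_gt0 v : v < 0 -> 0 < utility_scale v.
Proof. by move=> v_lt0; apply: powR_gt0; have := gamma_gt1; nra. Qed.

(** The condition [theta < 1] enters here: the exponent [1 - theta] is positive, while
    [(1 - gamma) * v] decreases in [v]. *)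
Lemma utility_scale_anti v v' :
  v <= v' -> v' < 0 -> utility_scale v' <= utility_scale v.
Proof.
move=> vv' v'_lt0.
rewrite /utility_scale; have h := gamma_gt1; have h1 := theta_lt1.
apply: ge0_ler_powR; rewrite ?nnegrE; nra.
Qed.

Lemma aggregatorE c v :
  agg c v = rho / (1 - psi^-1) * c `^ (1 - psi^-1) * utility_scale v.
Proof. by []. Qed.

Lemma marginal_gt0 c v : 0 < c -> v < 0 -> 0 < marginal c v.
Proof.
move=> c_gt0 v_lt0; rewrite !mulr_gt0 ?utility_scale_gt0 ?powR_gt0 //.
exact: rho_gt0.
Qed.

Lemma marginal_anti c c' v :
  0 < c -> c <= c' -> v < 0 -> marginal c' v <= marginal c v.
Proof.
move=> c_gt0 cc' v_lt0.
rewrite ler_pM2r ?utility_scale_gt0// ler_pM2l ?rho_gt0//.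
by apply: powR_neg_anti => //; rewrite oppr_lt0 invr_gt0.
Qed.

(** Concavity in consumption: the power is convex, but its coefficient [rho / (1 - psi^-1)] is
    negative. *)
Lemma aggregator_tangent c0 c v : 0 < c0 -> 0 < c -> v < 0 ->
  agg c v <= agg c0 v + marginal c0 v * (c - c0).
Proof.
move=> c0_gt0 c_gt0 v_lt0; rewrite !aggregatorE /marginal.
have a_lt0 := aggregator_exponent_lt0; have w_gt0 := utility_scale_gt0 v_lt0.
set a := 1 - psi^-1 in a_lt0 *; set w := utility_scale v in w_gt0 *.
have := @powR_neg_tangent R a c0 c a_lt0 c0_gt0 c_gt0.
rewrite (_ : a - 1 = - psi^-1); last by rewrite /a; ring.
set q := c0 `^ (- _); set d := c - c0; set f0 := c0 `^ a; set f := c `^ a => h.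
have -> : rho / a * f0 * w + rho * q * w * d
    = rho / a * w * (f0 + a * q * d).
  by field; rewrite lt_eqF.
rewrite [leLHS]mulrAC ler_nM2l// pmulr_llt0// pmulr_rlt0 ?rho_gt0//.
by rewrite invr_lt0.
Qed.

(** The concave objective [agg c v - c * p] has slope [marginal c0 v - p] at [c0]; if that slope
    does not point towards [c], then [c0] is at least as good. This covers interior and clipped
    optima alike. *)
Lemma clipped_optimum c0 c v p : 0 < c0 -> 0 < c -> v < 0 ->
  (marginal c0 v - p) * (c - c0) <= 0 -> agg c v - c * p <= agg c0 v - c0 * p.
Proof. by move=> h1 h2 h3 h4; have := aggregator_tangent h1 h2 h3; lra. Qed.

(** For [p > 0], [cstar] is the root of the first-order condition; for [p <= 0] the objective
    increases without end. *)
Lemma cstarP v p : v < 0 ->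
  (p <= 0 /\ cstar P v p = +oo%E) \/
  (0 < p /\ exists2 c, cstar P v p = c%:E & 0 < c /\ marginal c v = p).
Proof.
move=> v_lt0; have h := gamma_gt1; have h' := psi_gt0; have rhoK := rho_gt0.
have w_gt0 : 0 < (1 - gamma) * v by nra.
rewrite /cstar /pos_part_powN; have [p_le0|p_gt0] := leP p 0.
  left; split=> //; rewrite eqxx gt0_muley ?lte_fin ?powR_gt0//.
  by rewrite gt0_mulye ?lte_fin ?powR_gt0.
right; split=> //; rewrite gt_eqF// -!EFinM; eexists; first by [].
split; first by rewrite !mulr_gt0 ?powR_gt0.
rewrite /marginal /utility_scale.
move: ((1 - gamma) * v) w_gt0 => w w_gt0.
rewrite !powRM ?mulr_ge0 ?powR_ge0//.
rewrite -!powRrM.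
have -> : psi * - psi^-1 = -1 by field; lra.
have -> : - psi * - psi^-1 = 1 by field; lra.
(* With this exponent the power of [w] from [cstar] cancels the factor [utility_scale v]. *)
have -> : (1 - gamma * psi) / (1 - gamma) * - psi^-1 = - (1 - theta).
  by rewrite /theta; field; apply/andP; split; lra.
rewrite powR_inv1 ?ltW// powRr1 ?ltW// powRN.
by field; rewrite !gt_eqF ?powR_gt0.
Qed.

(** * Grid geometry and bounds on income *)

Lemma dx_gt0 : 0 < dx.
Proof. by rewrite divr_gt0 ?ltr0n//; have := xlo_le0; have := xhi_gt0; lra. Qed.

Lemma x_ge (i : node) : xlo P <= x i.
Proof. by rewrite lerDl mulr_ge0 ?ler0n ?ltW ?dx_gt0. Qed.

Lemma x_le (i : node) : x i <= xhi P.
Proof.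
have -> : xhi P = xlo P + (nI P)%:R * dx.
  by rewrite /Defs.dx; field; rewrite pnatr_eq0 -lt0n.
by rewrite lerD2l ler_pM2r ?dx_gt0// ler_nat -ltnS.
Qed.

(** As [xlo P <= 0] and [r < rho], one has [r * xlo P >= rho * xlo P], so the bound on [xlo P]
    suffices. *)
Lemma base_gt0 (i : node) : 0 < r * x i + y1 P.
Proof.
have := x_ge i; have := xlo_gt; have := xlo_le0.
have := r_gt0; have := r_lt_rho; nra. Qed.

Lemma y_ge1 j : y1 P <= y P j.
Proof. by rewrite /y; case: ifP => _ //; exact: ltW. Qed.

Lemma y_le2 j : y P j <= y2 P.
Proof. by rewrite /y; case: ifP => _ //; exact: ltW. Qed.

Lemma cbar_gt0 i j : 0 < cbar i j.
Proof. by rewrite /cbar; have := base_gt0 i; have := y_ge1 j; lra. Qed.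

Lemma cbar_le i j : cbar i j <= 1 / eps.
Proof. rewrite /cbar; have := x_le i; have := y_le2 j; have := eps_small;
  have := r_gt0; nra. Qed.

(** * Bounds and optimality of the consumption rules *)

Lemma cF_gt0 i j v p : v < 0 -> 0 < cF i j v p.
Proof.
move=> v_lt0; rewrite /cF; case: ifP => _; first exact: cbar_gt0.
have [[_ ->]|[_ [c -> [c_gt0 _]]]] := cstarP p v_lt0.
  by rewrite minye; exact: cbar_gt0.
by rewrite -EFin_min /= lt_min c_gt0 cbar_gt0.
Qed.

Lemma cF_le i j v p : v < 0 -> cF i j v p <= cbar i j.
Proof.
move=> v_lt0; rewrite /cF; case: ifP => _ //.
have [[_ ->]|[_ [c -> _]]] := cstarP p v_lt0; first by rewrite minye.
by rewrite -EFin_min /= ge_min lexx orbT.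
Qed.

Lemma cB_ge i j v p : v < 0 -> cbar i j <= cB i j v p.
Proof.
move=> v_lt0; rewrite /cB; case: ifP => _ //.
have [[_ ->]|[_ [c -> _]]] := cstarP p v_lt0.
  by rewrite miney -EFin_max /= le_max lexx orbT.
by rewrite -EFin_min -EFin_max /= le_max lexx orbT.
Qed.

Lemma cB_le i j v p : v < 0 -> cB i j v p <= 1 / eps.
Proof.
move=> v_lt0; rewrite /cB; case: ifP => _; first exact: cbar_le.
have [[_ ->]|[_ [c -> _]]] := cstarP p v_lt0.
  by rewrite miney -EFin_max /= ge_max lexx cbar_le.
by rewrite -EFin_min -EFin_max /= ge_max ge_min lexx cbar_le.
Qed.

(** If the unconstrained optimum exceeds [cbar], the objective still increases at [cbar], so
    clipping there is best among the smaller rates. *)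
Lemma cF_optimal i j v p c : v < 0 -> 0 < c -> c <= cbar i j ->
    (i = ord_max -> c = cbar i j) ->
  agg c v - c * p <= agg (cF i j v p) v - cF i j v p * p.
Proof.
move=> v_lt0 c_gt0 c_le cI.
apply: clipped_optimum => //; first exact: cF_gt0.
rewrite /cF; case: eqP => [/cI ->|_]; first by rewrite subrr mulr0.
have [[p_le0 ->]|[p_gt0 [c' -> [c'_gt0 <-]]]] := cstarP p v_lt0.
  by rewrite minye /=; have := marginal_gt0 (cbar_gt0 i j) v_lt0; nra.
rewrite -EFin_min /=; have [c'c|cc'] := leP c' (cbar i j).
  by rewrite subrr mul0r.
by have := marginal_anti (cbar_gt0 i j) (ltW cc') v_lt0; nra.
Qed.

(** Two clips can be active: the cap [1 / eps], where the objective still increases, and the floor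
    [cbar], where it already decreases. *)
Lemma cB_optimal i j v p c : v < 0 -> cbar i j <= c -> c <= 1 / eps ->
    (i = ord0 -> c = cbar i j) ->
  agg c v - c * p <= agg (cB i j v p) v - cB i j v p * p.
Proof.
move=> v_lt0 c_ge c_le cI; have cb := cbar_gt0 i j.
have eps_inv : 0 < 1 / eps by apply: lt_le_trans (cbar_le i j).
apply: clipped_optimum => //; [|exact: lt_le_trans c_ge|].
  by apply: lt_le_trans (cB_ge _ _ _ v_lt0).
rewrite /cB; case: eqP => [/cI ->|_]; first by rewrite subrr mulr0.
have cE := cbar_le i j.
have [[p_le0 ->]|[p_gt0 [c' -> [c'_gt0 <-]]]] := cstarP p v_lt0.
  rewrite miney -EFin_max /= max_l//.
  by have := marginal_gt0 eps_inv v_lt0; nra.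
rewrite -EFin_min -EFin_max /=; have [c'c|cc'] := leP (1 / eps) c'.
  rewrite max_l//.
  by have := marginal_anti eps_inv c'c v_lt0; nra.
have [c'b|bc'] := leP c' (cbar i j); last by rewrite subrr mul0r.
by have := marginal_anti c'_gt0 c'b v_lt0; nra.
Qed.


(** * The Hamiltonian as a maximum over policies *)

Definition policy_hamiltonian (i : node) (j : 'I_2) (cf cb v pF pB : R) : R :=
  (cbar i j - cf) * pF + (cbar i j - cb) * pB
  + agg cf v + agg cb v - agg (cbar i j) v.

Local Notation Hpol := policy_hamiltonian.

Lemma policy_hamiltonian_le i j cf cb v pF pB : v < 0 ->
    0 < cf -> cf <= cbar i j -> cbar i j <= cb -> cb <= 1 / eps ->
    (i = ord_max -> cf = cbar i j) -> (i = ord0 -> cb = cbar i j) ->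
  Hpol i j cf cb v pF pB <= Heps i j v pF pB.
Proof.
move=> v_lt0 cf_gt0 cf_le cb_ge cb_le cf_max cb_0.
have hF := cF_optimal pF v_lt0 cf_gt0 cf_le cf_max.
have hB := cB_optimal pB v_lt0 cb_ge cb_le cb_0.
by rewrite /Hpol /Heps; lra.
Qed.

(** The admissible range of policies depends neither on the utility argument nor on the differences,
    so a policy computed from other data still competes. *)
Lemma policy_improvement i j v v' pF pB qF qB : v < 0 -> v' < 0 ->
  Hpol i j (cF i j v' qF) (cB i j v' qB) v pF pB <= Heps i j v pF pB.
Proof.
move=> v_lt0 v'_lt0; apply: policy_hamiltonian_le => //.
- exact: cF_gt0.
- exact: cF_le.
- exact: cB_ge.
- exact: cB_le.
- by move=> ->; rewrite /cF eqxx.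
- by move=> ->; rewrite /cB eqxx.
Qed.

(* The aggregator terms carry the total factor [cf^a + cb^a - cbar^a] with
   [a = 1 - 1/psi < 0], which is nonnegative because [cf <= cbar]. *)
Lemma policy_hamiltonian_mono i j cf cb v v' pF pB :
    v <= v' -> v' < 0 -> 0 < cf -> cf <= cbar i j ->
  Hpol i j cf cb v pF pB <= Hpol i j cf cb v' pF pB.
Proof.
move=> vv' v'_lt0 cf_gt0 cf_le; rewrite /Hpol !aggregatorE.
have w_le := utility_scale_anti vv' v'_lt0.
have a_lt0 := aggregator_exponent_lt0.
have f_le := powR_neg_anti a_lt0 cf_gt0 cf_le.
have fb := powR_ge0 cb (1 - psi^-1).
have A_lt0 : rho / (1 - psi^-1) < 0.
  by rewrite pmulr_rlt0 ?rho_gt0// invr_lt0.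
set w := utility_scale v in w_le *; set w' := utility_scale v' in w_le *.
set A := rho / _ in A_lt0 *.
set f := cf `^ _ in f_le *; set b := cbar i j `^ _ in f_le *.
set e := cb `^ _ in fb *.
have K_ge0 : 0 <= f + e - b by lra.
have : 0 <= (f + e - b) * (w - w') by apply: mulr_ge0 => //; lra.
set K := _ * _ => K_ge.
have : A * K <= 0 by nra.
rewrite /K; lra.
Qed.

(** The policy optimal at [v] does no worse at [v'], where the maximum dominates it. *)
Lemma Heps_mono i j v v' pF pB :
  v <= v' -> v' < 0 -> Heps i j v pF pB <= Heps i j v' pF pB.
Proof.
move=> vv' v'_lt0; have v_lt0 := le_lt_trans vv' v'_lt0.
apply: le_trans (policy_improvement i j pF pB pF pB v'_lt0 v_lt0).
by apply: policy_hamiltonian_mono; rewrite ?cF_gt0 ?cF_le.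
Qed.

(** Both drifts are at most [1 / eps] in absolute value, whatever the policy; this uniformity lets
    the policy vary along a sequence. *)
Lemma policy_hamiltonian_lipschitz i j cf cb v pF pB qF qB :
    0 < cf -> cf <= cbar i j -> cbar i j <= cb -> cb <= 1 / eps ->
  Hpol i j cf cb v pF pB <=
    Hpol i j cf cb v qF qB + (1 / eps) * (`|pF - qF| + `|pB - qB|).
Proof.
move=> cf_gt0 cf_le cb_ge cb_le; rewrite /Hpol.
have cb_gt0 := cbar_gt0 i j; have cE := cbar_le i j.
have hF : (cbar i j - cf) * (pF - qF) <= (1 / eps) * `|pF - qF|.
  apply: le_trans (ler_norm _) _; rewrite normrM ler_wpM2r// ger0_norm; lra.
have hB : (cbar i j - cb) * (pB - qB) <= (1 / eps) * `|pB - qB|.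
  apply: le_trans (ler_norm _) _; rewrite normrM ler_wpM2r// ler0_norm; lra.
lra.
Qed.

Lemma cvg_lipschitz_error (f f' g g' : nat -> R) (a b C : R) :
  f @ \oo --> a -> f' @ \oo --> a -> g @ \oo --> b -> g' @ \oo --> b ->
  (fun n => C * (`|f n - f' n| + `|g n - g' n|)) @ \oo --> (0 : R).
Proof.
move=> fa f'a gb g'b; rewrite -[X in _ --> X](mulr0 C) -[X in C * X](addr0 0).
apply: cvgM; first exact: cvg_cst.
apply: cvgD.
  rewrite -[X in _ --> X](@normr0 _ R) -[X in `|X|](subrr a).
  by apply: cvg_norm; exact: cvgB.
rewrite -[X in _ --> X](@normr0 _ R) -[X in `|X|](subrr b).
by apply: cvg_norm; exact: cvgB.
Qed.

(* Heps is a maximum over policies: the optimal policy of the limit bounds the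
   sequence from below, and the optimal policies of the sequence, which lie in
   a bounded set, bound it from above. *)
Lemma Heps_cvg i j (v pF pB : nat -> R) (v0 qF qB : R) :
    v0 < 0 -> (forall n, v n <= v0) ->
    v @ \oo --> v0 -> pF @ \oo --> qF -> pB @ \oo --> qB ->
  (fun n => Heps i j (v n) (pF n) (pB n)) @ \oo --> Heps i j v0 qF qB.
Proof.
move=> v0_lt0 v_le vv0 pFq pBq.
have v_lt0 n : v n < 0 by exact: le_lt_trans (v_le n) v0_lt0.
have agg_cvg c : (fun n => agg c (v n)) @ \oo --> agg c v0.
  apply: cvgM; first exact: cvg_cst.
  apply: cvg_powR; first by have := gamma_gt1; nra.
  by apply: cvgM => //; exact: cvg_cst.
apply: (@squeeze_cvgr _ _ _ _
  (fun n => Hpol i j (cF i j v0 qF) (cB i j v0 qB) (v n) (pF n) (pB n))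
  (fun n => Heps i j v0 qF qB
     + (1 / eps) * (`|pF n - qF| + `|pB n - qB|))).
- apply: nearW => n; apply/andP; split; first exact: policy_improvement.
  apply: (@le_trans _ _ (Hpol i j (cF i j (v n) (pF n))
                           (cB i j (v n) (pB n)) v0 (pF n) (pB n))).
    by apply: policy_hamiltonian_mono; rewrite ?cF_gt0 ?cF_le.
  have lip := policy_hamiltonian_lipschitz v0 (pF n) (pB n) qF qB
    (cF_gt0 i j (pF n) (v_lt0 n)) (cF_le i j (pF n) (v_lt0 n))
    (cB_ge i j (pB n) (v_lt0 n)) (cB_le i j (pB n) (v_lt0 n)).
  by apply: le_trans lip _; rewrite lerD2r; exact: policy_improvement.
- rewrite /Heps; apply: cvgB => //; apply: cvgD => //; apply: cvgD => //.
  by apply: cvgD; apply: cvgM => //; exact: cvg_cst.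
- rewrite -[X in _ --> X]addr0; apply: cvgD; first exact: cvg_cst.
  exact: (cvg_lipschitz_error _ pFq (cvg_cst qF) pBq (cvg_cst qB)).
Qed.

(** * Discrete maximum principle and comparison for a fixed policy *)

Definition coupling (W : grid) (i : node) (j : 'I_2) : R :=
  lambda P j * (W i (rev_ord j) - W i j).

Lemma lambda_gt0 j : 0 < lambda P j.
Proof. by rewrite /lambda; case: ifP. Qed.

Lemma rho_theta_gt0 : 0 < rho / theta.
Proof. by rewrite divr_gt0// rho_gt0. Qed.

(** At a global maximum of [D] every term on the right is nonpositive. *)
Lemma discrete_maximum_principle (sF sB : node -> 'I_2 -> R) (D : grid) :
    (forall i j, 0 <= sF i j) -> (forall i j, sB i j <= 0) ->
    (forall i j, rho / theta * D i j <=
       sF i j * Dplus D i j + sB i j * Dminus D i j + coupling D i j) ->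
  forall i j, D i j <= 0.
Proof.
move=> sF_ge0 sB_le0 D_sub.
have [[i0 j0] _ D_max] := @Order.TotalTheory.arg_maxP _ _ _
  (ord0 : node, ord0 : 'I_2) xpredT (fun p => D p.1 p.2) isT.
have {}D_max i j : D i j <= D i0 j0 by exact: (D_max (i, j)).
move=> i j; apply: le_trans (D_max i j) _.
(* At an end node [inord] still returns some node, and a global maximum dominates that one too. *)
have hF : Dplus D i0 j0 <= 0.
  by rewrite /Dplus pmulr_lle0 ?invr_gt0 ?dx_gt0// subr_le0.
have hB : 0 <= Dminus D i0 j0.
  by rewrite /Dminus pmulr_lge0 ?invr_gt0 ?dx_gt0// subr_ge0.
have hC : coupling D i0 j0 <= 0.
  by rewrite /coupling pmulr_rle0 ?lambda_gt0// subr_le0.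
rewrite -(pmulr_rle0 _ rho_theta_gt0); apply: le_trans (D_sub i0 j0) _.
have hF' : sF i0 j0 * Dplus D i0 j0 <= 0 by rewrite mulr_ge0_le0.
have hB' : sB i0 j0 * Dminus D i0 j0 <= 0 by rewrite mulr_le0_ge0.
lra.
Qed.

Lemma DplusB (W Z : grid) i j : Dplus (W - Z) i j = Dplus W i j - Dplus Z i j.
Proof. by rewrite /Dplus !mxE; lra. Qed.

Lemma DminusB (W Z : grid) i j :
  Dminus (W - Z) i j = Dminus W i j - Dminus Z i j.
Proof. by rewrite /Dminus !mxE; lra. Qed.

Lemma couplingB (W Z : grid) i j :
  coupling (W - Z) i j = coupling W i j - coupling Z i j.
Proof. by rewrite /coupling !mxE; lra. Qed.

(** For a common policy and a common [v] the aggregator terms cancel in the difference [W - Z],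
    which leaves the linear inequality of the maximum principle. *)
Lemma policy_comparison (cf cb : node -> 'I_2 -> R) (v W Z : grid) :
    (forall i j, cf i j <= cbar i j) -> (forall i j, cbar i j <= cb i j) ->
    (forall i j, rho / theta * W i j <=
       Hpol i j (cf i j) (cb i j) (v i j) (Dplus W i j) (Dminus W i j)
       + coupling W i j) ->
    (forall i j,
       Hpol i j (cf i j) (cb i j) (v i j) (Dplus Z i j) (Dminus Z i j)
       + coupling Z i j <= rho / theta * Z i j) ->
  grid_le W Z.
Proof.
move=> cf_le cb_ge W_sub Z_super i j; rewrite -subr_le0.
have -> : W i j - Z i j = (W - Z) i j by rewrite !mxE.
move: i j; apply: (@discrete_maximum_principle
  (fun i j => cbar i j - cf i j) (fun i j => cbar i j - cb i j)) => i j.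
- by rewrite subr_ge0.
- by rewrite subr_le0.
rewrite DplusB DminusB couplingB; have := W_sub i j; have := Z_super i j.
rewrite /Hpol !mxE; lra.
Qed.

Definition negative (v : grid) : Prop := forall i j, v i j < 0.

(** Freezing [v] separately serves both loops: [subsolution v v] is the notion for the original
    system. *)
Definition subsolution (v W : grid) : Prop := forall i j,
  rho / theta * W i j <=
  Heps i j (v i j) (Dplus W i j) (Dminus W i j) + coupling W i j.

Definition supersolution (v Z : grid) : Prop := forall i j,
  Heps i j (v i j) (Dplus Z i j) (Dminus Z i j) + coupling Z i j <=
  rho / theta * Z i j.

Lemma grid_le_anti (V W : grid) : grid_le V W -> grid_le W V -> V = W.
Proof.
by move=> VW WV; apply/matrixP => i j; apply/le_anti; rewrite VW WV.
Qed.

Lemma grid_le_trans (U V W : grid) : grid_le U V -> grid_le V W -> grid_le U W.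
Proof. by move=> UV VW i j; apply: le_trans (UV i j) (VW i j). Qed.

Lemma grid_le_negative (V W : grid) : grid_le V W -> negative W -> negative V.
Proof. by move=> VW W0 i j; apply: le_lt_trans (VW i j) (W0 i j). Qed.

Lemma subsolution_mono v v' W :
  grid_le v v' -> negative v' -> subsolution v W -> subsolution v' W.
Proof.
move=> vv' v'_lt0 W_sub i j; apply: le_trans (W_sub i j) _.
by rewrite lerD2r; exact: Heps_mono.
Qed.

Lemma supersolution_mono v v' Z :
  grid_le v v' -> negative v' -> supersolution v' Z -> supersolution v Z.
Proof.
move=> vv' v'_lt0 Z_super i j; apply: le_trans (Z_super i j).
by rewrite lerD2r; exact: Heps_mono.
Qed.

Lemma frozen_subsolution v W : frozen_system v W -> subsolution v W.
Proof. by move=> vW i j; rewrite vW. Qed.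

Lemma frozen_supersolution v W : frozen_system v W -> supersolution v W.
Proof. by move=> vW i j; rewrite [leRHS]vW. Qed.

(** For the policy optimal at [W], the inequality for [W] is unchanged, while [Z] is a supersolution
    for every policy because it is one for their maximum. *)
Lemma comparison v W Z :
  negative v -> subsolution v W -> supersolution v Z -> grid_le W Z.
Proof.
move=> v_lt0 W_sub Z_super.
apply: (@policy_comparison (fun i j => cF i j (v i j) (Dplus W i j))
  (fun i j => cB i j (v i j) (Dminus W i j)) v) => i j.
- exact: cF_le.
- exact: cB_ge.
- exact: W_sub.
- apply: le_trans (Z_super i j); rewrite lerD2r; exact: policy_improvement.
Qed.

(** * The inner Howard iteration *)

Lemma howard_systemE v W W' : howard_system v W W' <-> forall i j,
  rho / theta * W' i j =
  Hpol i j (cF i j (v i j) (Dplus W i j)) (cB i j (v i j) (Dminus W i j))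
    (v i j) (Dplus W' i j) (Dminus W' i j) + coupling W' i j.
Proof. by []. Qed.

(** The maximum principle makes the kernel of the homogeneous system trivial, and in finite
    dimension injectivity gives surjectivity. *)
Lemma howard_system_exists v W :
  negative v -> exists W', howard_system v W W'.
Proof.
move=> v_lt0.
pose cf i j := cF i j (v i j) (Dplus W i j).
pose cb i j := cB i j (v i j) (Dminus W i j).
pose L (D : grid) : grid := \matrix_(i, j) (rho / theta * D i j
  - (cbar i j - cf i j) * Dplus D i j - (cbar i j - cb i j) * Dminus D i j
  - coupling D i j).
have L_lin : linear L.
  move=> a D D'; apply/matrixP => i j.
  by rewrite !mxE /Dplus /Dminus /coupling !mxE; lra.
have L_le0 D : L D = 0 -> forall i j, D i j <= 0.
  move=> /matrixP LD; apply: (@discrete_maximum_principle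
    (fun i j => cbar i j - cf i j) (fun i j => cbar i j - cb i j)) => i j.
  - by rewrite subr_ge0 cF_le.
  - by rewrite subr_le0 cB_ge.
  - by have := LD i j; rewrite !mxE; lra.
have L_ker D : L D = 0 -> D = 0.
  move=> LD; apply/matrixP => i j; apply/le_anti; rewrite mxE L_le0//=.
  (* The opposite sign comes from [- D], written as [-1 *: D + 0] to match the form of [L_lin]. *)
  have := L_le0 (- D); rewrite -scaleN1r -[_ *: _]addr0.
  rewrite L_lin LD scaler0 add0r; have -> : L 0 = 0.
    by rewrite -[X in L X](subrr 0) -scaleN1r addrC L_lin scaleN1r addNr.
  by move=> /(_ erefl i j); rewrite !mxE; lra.
have [W' LW'] := injective_linear_surj L_lin L_ker
  (\matrix_(i, j) (agg (cf i j) (v i j) + agg (cb i j) (v i j)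
     - agg (cbar i j) (v i j))).
exists W'; apply/howard_systemE => i j; move/matrixP/(_ i j): LW'.
by rewrite !mxE /Hpol /cf /cb; lra.
Qed.

Lemma howard_system_unique v W W1 W2 : negative v ->
  howard_system v W W1 -> howard_system v W W2 -> W1 = W2.
Proof.
move=> v_lt0 W1P W2P; apply: grid_le_anti;
  apply: (@policy_comparison (fun i j => cF i j (v i j) (Dplus W i j))
    (fun i j => cB i j (v i j) (Dminus W i j)) v) => i j;
  try exact: cF_le; try exact: cB_ge.
- by have/howard_systemE -> := W1P.
- by have/howard_systemE <- := W2P.
- by have/howard_systemE -> := W2P.
- by have/howard_systemE <- := W1P.
Qed.

Lemma howard_stepP v W : negative v -> howard_system v W (howard_step v W).
Proof.
move=> v_lt0; have [W' W'P] := howard_system_exists W v_lt0.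
exact: xgetI W'P.
Qed.

(** The policy used in the step attains [Heps] at [W], so [W] is a subsolution of the linear system
    that the step solves exactly. *)
Lemma howard_step_ge v W :
  negative v -> subsolution v W -> grid_le W (howard_step v W).
Proof.
move=> v_lt0 W_sub; have W'P := howard_stepP W v_lt0.
apply: (@policy_comparison (fun i j => cF i j (v i j) (Dplus W i j))
    (fun i j => cB i j (v i j) (Dminus W i j)) v) => i j.
- exact: cF_le.
- exact: cB_ge.
- exact: W_sub.
- by have/howard_systemE <- := W'P.
Qed.

Lemma howard_step_subsolution v W :
  negative v -> subsolution v (howard_step v W).
Proof.
move=> v_lt0 i j; have/howard_systemE -> := howard_stepP W v_lt0.
by rewrite lerD2r; exact: policy_improvement.
Qed.

Lemma cvg_Dplus (W : nat -> grid) (L : grid) i j :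
  (forall i j, (fun n => W n i j) @ \oo --> L i j) ->
  (fun n => Dplus (W n) i j) @ \oo --> Dplus L i j.
Proof.
move=> WL; apply: cvgM; last exact: cvg_cst.
by apply: cvgB; exact: WL.
Qed.

Lemma cvg_Dminus (W : nat -> grid) (L : grid) i j :
  (forall i j, (fun n => W n i j) @ \oo --> L i j) ->
  (fun n => Dminus (W n) i j) @ \oo --> Dminus L i j.
Proof.
move=> WL; apply: cvgM; last exact: cvg_cst.
by apply: cvgB; exact: WL.
Qed.

Lemma cvg_coupling (W : nat -> grid) (L : grid) i j :
  (forall i j, (fun n => W n i j) @ \oo --> L i j) ->
  (fun n => coupling (W n) i j) @ \oo --> coupling L i j.
Proof.
move=> WL; apply: cvgM; first exact: cvg_cst.
by apply: cvgB; exact: WL.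
Qed.

Lemma howard_cvg v Z : negative v -> subsolution v v -> supersolution v Z ->
  exists W, [/\ howard v @ \oo --> W, frozen_system v W,
                grid_le v W & grid_le W Z].
Proof.
move=> v_lt0 v_sub Z_super.
have W_sub n : subsolution v (howard v n).
  by case: n => [|n] //; exact: howard_step_subsolution.
have W_nd n i j : howard v n i j <= howard v n.+1 i j.
  exact: howard_step_ge.
have W_le n : grid_le (howard v n) Z by exact: comparison (W_sub n) Z_super.
have [W [WW Wij W_ge W_leZ]] := nondecreasing_mx_cvg W_nd W_le.
exists W; split => //; last by move=> i j; exact: (W_ge 0%N).
move=> i j.
have WS i' j' : (fun n => howard v n.+1 i' j') @ \oo --> W i' j'.
  by rewrite (cvg_shiftS (fun n => howard v n i' j')).
have WS_cvg : (fun n => rho / theta * howard v n.+1 i j) @ \oo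
    --> rho / theta * W i j.
  by apply: cvgM => //; exact: cvg_cst.
have Heps_lim (V : nat -> grid) :
    (forall i j, (fun n => V n i j) @ \oo --> W i j) ->
    (fun n => Heps i j (v i j) (Dplus (V n) i j) (Dminus (V n) i j)) @ \oo
      --> Heps i j (v i j) (Dplus W i j) (Dminus W i j).
  move=> VW; apply: (Heps_cvg (v := fun=> v i j)) => //; first exact: cvg_cst.
  - exact: cvg_Dplus.
  - exact: cvg_Dminus.
(* One inequality is the limit of the subsolution property of the iterates. *)
apply/le_anti/andP; split.
  have upper_cvg : (fun n => Heps i j (v i j) (Dplus (howard v n.+1) i j)
      (Dminus (howard v n.+1) i j) + coupling (howard v n.+1) i j) @ \oo
      --> Heps i j (v i j) (Dplus W i j) (Dminus W i j) + coupling W i j.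
    by apply: cvgD; [exact: Heps_lim | exact: cvg_coupling].
  apply: (ler_cvg_to WS_cvg upper_cvg).
  by apply: nearW => n; exact: W_sub.
(* For the other, the policy of iterate [n.+1] attains [Heps] at iterate [n]; evaluating it at
   iterate [n.+1] costs only a Lipschitz error, which vanishes as both sequences have the same
   limit. *)
have err_cvg := cvg_lipschitz_error (1 / eps) (@cvg_Dplus _ _ i j Wij)
  (@cvg_Dplus _ _ i j WS) (@cvg_Dminus _ _ i j Wij) (@cvg_Dminus _ _ i j WS).
have lower_cvg : (fun n => Heps i j (v i j) (Dplus (howard v n) i j)
      (Dminus (howard v n) i j) + coupling (howard v n.+1) i j
      - 1 / eps * (`|Dplus (howard v n) i j - Dplus (howard v n.+1) i j|
        + `|Dminus (howard v n) i j - Dminus (howard v n.+1) i j|)) @ \oo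
    --> Heps i j (v i j) (Dplus W i j) (Dminus W i j) + coupling W i j.
  rewrite -[X in _ --> X]subr0; apply: cvgB err_cvg.
  by apply: cvgD; [exact: Heps_lim | exact: cvg_coupling].
apply: (ler_cvg_to lower_cvg WS_cvg); apply: nearW => n /=.
have /howard_systemE/(_ i j) -> := howard_stepP (howard v n) v_lt0.
rewrite lerBlDr [leRHS]addrAC lerD2r.
by apply: policy_hamiltonian_lipschitz;
  rewrite ?cF_gt0 ?cF_le ?cB_ge ?cB_le.
Qed.

(** * The barriers [checkU] and [checkV] *)

Lemma bcoef_gt0 : 0 < bcoef P.
Proof.
rewrite mulr_gt0 ?rho_gt0// powR_gt0// divr_gt0 ?rho_gt0//.
by have := r_gt0; have := psi_gt0; have := r_lt_rho; nra.
Qed.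

(** Bernoulli with exponent [1 / (1 - psi)] bounds [bcoef P / rho] below by exactly [r / rho]. This
    orders the two barriers. *)
Lemma bcoef_ge_r : r <= bcoef P.
Proof.
have h := rho_gt0; have hr := r_gt0; have hp := psi_gt0.
have hp1 := psi_lt1; have hr1 := r_lt_rho.
rewrite /bcoef mulrC -ler_pdivrMr//.
have m_gt0 : 0 < (r + psi * (rho - r)) / rho by rewrite divr_gt0//; nra.
have e_gt1 : 1 < 1 / (1 - psi) by rewrite ltr_pdivlMr; lra.
apply: le_trans (powR_bernoulli e_gt1 m_gt0).
rewrite [leRHS](_ : _ = r / rho)//.
by field; apply/andP; split; lra.
Qed.

Lemma bcoef_powR :
  bcoef P `^ (1 - psi) = rho `^ (- psi) * (r + psi * (rho - r)).
Proof.
have h := rho_gt0; have hr := r_gt0; have hp := psi_gt0.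
have hp1 := psi_lt1; have hr1 := r_lt_rho.
have k_gt0 : 0 < r + psi * (rho - r) by nra.
rewrite /bcoef powRM ?powR_ge0 ?ltW// -powRrM.
have -> : 1 / (1 - psi) * (1 - psi) = 1 by field; lra.
rewrite powRr1 ?divr_ge0 ?ltW// powRB ?powRN ?powRr1 ?ltW//.
  by field; rewrite !gt_eqF ?powR_gt0.
by rewrite (gt_eqF h) implybT.
Qed.

(** Wealth plus the value of receiving [y2 P] forever, discounted at rate [r]. *)
Definition shifted (i : node) : R := x i + y2 P / r.

Lemma r_shifted i : r * shifted i = r * x i + y2 P.
Proof. by rewrite /shifted; field; rewrite gt_eqF. Qed.

Lemma shifted_gt0 i : 0 < shifted i.
Proof.
rewrite -(pmulr_rgt0 _ r_gt0) r_shifted.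
by have := base_gt0 i; have := y1_lt_y2; lra.
Qed.

Lemma checkU_lt0 : negative (checkU P).
Proof.
move=> i j; rewrite mxE pmulr_rlt0 ?invr_lt0 ?powR_gt0 ?base_gt0//.
by have := gamma_gt1; lra.
Qed.

Lemma checkV_lt0 : negative (checkV P).
Proof.
move=> i j; rewrite mxE pmulr_rlt0 ?invr_lt0 ?powR_gt0//.
  by have := gamma_gt1; lra.
by rewrite mulr_gt0 ?bcoef_gt0 ?shifted_gt0.
Qed.

Lemma checkU_le_checkV : grid_le (checkU P) (checkV P).
Proof.
move=> i j; rewrite !mxE.
have g_lt0 : 1 - gamma < 0 by have := gamma_gt1; lra.
rewrite ler_nM2r ?invr_lt0//; apply: powR_neg_anti => //; first exact: base_gt0.
have := r_shifted i; have := shifted_gt0 i; have := bcoef_ge_r.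
by have := y1_lt_y2; rewrite /shifted; nra.
Qed.

Lemma theta_exponent : theta * (1 - gamma) = 1 - psi^-1.
Proof.
by rewrite /Defs.theta; field; have := gamma_gt1; have := psi_gt0; lra.
Qed.

(** Test the Hamiltonian with zero saving, [cf = cb = cbar]: both drifts vanish and one aggregator
    term remains. Replacing income [y P j] by [y1 P] lowers it to [rho / theta * checkU P i j]. *)
Lemma checkU_subsolution : subsolution (checkU P) (checkU P).
Proof.
move=> i j.
have cb := cbar_gt0 i j; have a_gt0 := base_gt0 i.
have U_lt0 := checkU_lt0 i j.
have coup0 : coupling (checkU P) i j = 0.
  by rewrite /coupling !mxE subrr mulr0.
rewrite coup0 addr0; apply: le_trans (policy_hamiltonian_le
  _ _ U_lt0 cb (lexx _) (lexx _) (cbar_le i j) (fun=> erefl) (fun=> erefl)).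
rewrite /Hpol !subrr !mul0r !add0r addrK.
have g_lt0 : 1 - gamma < 0 by have := gamma_gt1; lra.
have t_gt0 := theta_gt0; have e_lt0 := aggregator_exponent_lt0.
have base_le : r * x i + y1 P <= cbar i j by rewrite lerD2l y_ge1.
have w_gt0 := utility_scale_gt0 U_lt0.
rewrite aggregatorE.
apply: (@le_trans _ _ (rho / (1 - psi^-1) * (r * x i + y1 P) `^ (1 - psi^-1)
   * utility_scale (checkU P i j))); last first.
  rewrite ler_pM2r// ler_nM2l ?pmulr_rlt0 ?rho_gt0 ?invr_lt0//.
  exact: powR_neg_anti.
rewrite /utility_scale mxE mulrC.
set a := r * x i + y1 P in a_gt0 *.
have -> : (1 - gamma) * (a `^ (1 - gamma) / (1 - gamma)) = a `^ (1 - gamma).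
  by field; rewrite lt_eqF.
rewrite -powRrM -theta_exponent -mulrA -powRD; last first.
  by rewrite (gt_eqF a_gt0) implybT.
have -> : theta * (1 - gamma) + (1 - gamma) * (1 - theta) = 1 - gamma by ring.
rewrite le_eqVlt; apply/orP; left; apply/eqP; field.
lra.
Qed.

(* [checkV] samples a concave function of [x], of which this is the
   derivative. *)
Definition slopeV (i : node) : R :=
  bcoef P `^ (1 - gamma) * shifted i `^ (- gamma).

Lemma slopeV_gt0 i : 0 < slopeV i.
Proof. by rewrite mulr_gt0 ?powR_gt0 ?bcoef_gt0 ?shifted_gt0. Qed.

Lemma checkVE i j :
  checkV P i j =
  bcoef P `^ (1 - gamma) * shifted i `^ (1 - gamma) / (1 - gamma).
Proof. by rewrite mxE powRM ?ltW ?bcoef_gt0 ?shifted_gt0. Qed.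

Lemma checkV_slopeV i j :
  (1 - gamma) * checkV P i j = slopeV i * shifted i.
Proof.
have g_lt0 : 1 - gamma < 0 by have := gamma_gt1; lra.
have z_gt0 := shifted_gt0 i.
rewrite checkVE /slopeV.
have -> : shifted i `^ (1 - gamma) = shifted i `^ (- gamma) * shifted i.
  rewrite powRD ?powRr1 ?ltW//; first by ring.
  by rewrite (gt_eqF z_gt0) implybT.
by field; rewrite lt_eqF.
Qed.

(** The tangent bound between arbitrary nodes yields both one-sided difference bounds, by taking
    [i'] on either side of [i]. *)
Lemma checkV_tangent i i' j :
  checkV P i' j <= checkV P i j + slopeV i * (x i' - x i).
Proof.
have g_lt0 : 1 - gamma < 0 by have := gamma_gt1; lra.
have := powR_neg_tangent g_lt0 (shifted_gt0 i) (shifted_gt0 i').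
rewrite !checkVE /slopeV (_ : 1 - gamma - 1 = - gamma); last by ring.
rewrite (_ : shifted i' - shifted i = x i' - x i); last first.
  by rewrite /shifted; ring.
set b := bcoef P `^ _; set f := shifted i `^ (1 - gamma).
set f' := shifted i' `^ (1 - gamma); set q := _ `^ (- gamma).
set d := x i' - x i => h.
have b_gt0 : 0 < b by rewrite powR_gt0 ?bcoef_gt0.
have -> : b * f / (1 - gamma) + b * q * d
    = b * (f + (1 - gamma) * q * d) / (1 - gamma).
  by field; rewrite lt_eqF.
by rewrite ler_nM2r ?invr_lt0// ler_pM2l.
Qed.

Lemma checkV_Dplus_le i j :
  i != ord_max -> Dplus (checkV P) i j <= slopeV i.
Proof.
move=> i_max; have i_lt : (i.+1 < (nI P).+1)%N.
  by rewrite ltnS ltn_neqAle i_max -ltnS ltn_ord.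
rewrite /Dplus ler_pdivrMr ?dx_gt0// lerBlDl.
apply: le_trans (checkV_tangent i _ j) _.
by rewrite /x inordK// -natr1; lra.
Qed.

Lemma checkV_Dminus_ge i j :
  i != ord0 -> slopeV i <= Dminus (checkV P) i j.
Proof.
move=> i_0; have i_gt0 : (0 < i)%N by rewrite lt0n.
have i_lt : (i.-1 < (nI P).+1)%N by rewrite (leq_ltn_trans (leq_pred _)).
rewrite /Dminus ler_pdivlMr ?dx_gt0// lerBrDl.
rewrite -lerBrDr; apply: le_trans (checkV_tangent i _ j) _.
rewrite /x inordK// -[in X in _ - X](prednK i_gt0) -natr1; lra.
Qed.

(* The consumption rate [r + psi (rho - r)] per unit of [x + y2 / r] is the
   optimal one for [checkV]; [bcoef] is chosen to make this true. *)
Lemma checkV_marginal i j :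
  marginal ((r + psi * (rho - r)) * shifted i) (checkV P i j) = slopeV i.
Proof.
have h := rho_gt0; have hr := r_gt0; have hp := psi_gt0; have hg := gamma_gt1.
have hp1 := psi_lt1; have hr1 := r_lt_rho.
have b_gt0 := bcoef_gt0; have z_gt0 := shifted_gt0 i.
have k_gt0 : 0 < r + psi * (rho - r) by nra.
have kE : r + psi * (rho - r) = rho `^ psi * bcoef P `^ (1 - psi).
  by rewrite bcoef_powR powRN; field; rewrite gt_eqF ?powR_gt0.
rewrite /marginal /utility_scale checkV_slopeV /slopeV kE.
clear kE; move: (bcoef P) (shifted i) b_gt0 z_gt0 => b z b_gt0 z_gt0.
have eqexp (t u v : R) : 0 < t -> t `^ u * t `^ v = t `^ (u + v).
  by move=> t0; rewrite powRD// (gt_eqF t0) implybT.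
have zE : z `^ (1 - gamma) = z `^ (- gamma) * z.
  by rewrite addrC -eqexp// powRr1// ltW.
have -> : b `^ (1 - gamma) * z `^ (- gamma) * z = (b * z) `^ (1 - gamma).
  by rewrite powRM ?ltW// zE mulrA.
rewrite -powRrM !powRM ?mulr_ge0 ?powR_ge0 ?ltW// -!powRrM.
have -> : psi * - psi^-1 = -1 by field; lra.
have -> : (1 - gamma) * (1 - theta) = psi^-1 - gamma.
  by rewrite mulrBr mulr1 mulrC theta_exponent; ring.
rewrite powR_inv1 ?ltW//.
have -> : rho * (rho^-1 * b `^ ((1 - psi) * - psi^-1) * z `^ (- psi^-1))
    * (b `^ (psi^-1 - gamma) * z `^ (psi^-1 - gamma))
  = (b `^ ((1 - psi) * - psi^-1) * b `^ (psi^-1 - gamma))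
    * (z `^ (- psi^-1) * z `^ (psi^-1 - gamma)).
  by field; rewrite gt_eqF.
rewrite !eqexp//; congr (_ `^ _ * _ `^ _); last by ring.
by field; lra.
Qed.

Lemma checkV_supersolution : supersolution (checkV P) (checkV P).
Proof.
move=> i j; have V_lt0 := checkV_lt0 i j.
have coup0 : coupling (checkV P) i j = 0.
  by rewrite /coupling !mxE subrr mulr0.
rewrite coup0 addr0.
have h := rho_gt0; have hr := r_gt0; have hp := psi_gt0; have hg := gamma_gt1.
have hp1 := psi_lt1; have hr1 := r_lt_rho; have t_gt0 := theta_gt0.
have z_gt0 := shifted_gt0 i; have q_gt0 := slopeV_gt0 i.
have k_gt0 : 0 < r + psi * (rho - r) by nra.
have muE := checkV_marginal i j.
set k := r + psi * (rho - r) in k_gt0 muE.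
set c0 := k * shifted i in muE.
have c0_gt0 : 0 < c0 by rewrite mulr_gt0.
set v := checkV P i j in V_lt0 muE *; set q := slopeV i in q_gt0 muE *.
set pF := Dplus _ _ _; set pB := Dminus _ _ _.
have cb_gt0 := cbar_gt0 i j.
have cf_gt0 := cF_gt0 i j pF V_lt0; have cf_le := cF_le i j pF V_lt0.
have cb_ge := cB_ge i j pB V_lt0.
rewrite /Heps.
(* Concavity and the signs of the drifts allow both differences to be replaced by the one slope [q];
   at an end node the drift is zero. *)
have driftF : (cbar i j - cF i j v pF) * pF <= (cbar i j - cF i j v pF) * q.
  have [->|i_max] := eqVneq i ord_max; first by rewrite /cF eqxx subrr !mul0r.
  by rewrite ler_wpM2l ?subr_ge0// checkV_Dplus_le.
have driftB : (cbar i j - cB i j v pB) * pB <= (cbar i j - cB i j v pB) * q.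
  have [->|i_0] := eqVneq i ord0; first by rewrite /cB eqxx subrr !mul0r.
  by rewrite ler_wnM2l ?subr_le0// checkV_Dminus_ge.
move: (cF _ _ _ _) (cB _ _ _ _) cf_gt0 cf_le cb_ge driftF driftB.
move=> cf cb cf_gt0 cf_le cb_ge driftF driftB.
have cbp := lt_le_trans cb_gt0 cb_ge.
(* The objective increases up to [c0] and decreases afterwards. *)
have obj : agg cf v - cf * q + (agg cb v - cb * q)
    <= agg (cbar i j) v - cbar i j * q + (agg c0 v - c0 * q).
  have opt c : 0 < c -> agg c v - c * q <= agg c0 v - c0 * q.
    by move=> c_gt0; apply: clipped_optimum; rewrite ?muE ?subrr ?mul0r.
  (* Of [cf <= cbar <= cb], the rate lying beyond [cbar] as seen from [c0] is compared with [cbar],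
     the other one with [c0]. *)
  have [c0_le|c0_ge] := leP c0 (cbar i j).
    rewrite addrC lerD ?opt//; apply: clipped_optimum => //.
    by have := marginal_anti c0_gt0 c0_le V_lt0; rewrite muE; nra.
  rewrite lerD ?opt//; apply: clipped_optimum => //.
  by have := marginal_anti cb_gt0 (ltW c0_ge) V_lt0; rewrite muE; nra.
have cbar_le_rz : cbar i j * q <= r * shifted i * q.
  by rewrite ler_pM2r// r_shifted lerD2l y_le2.
(* After division by [q * shifted i] this is [r - k / (1 - psi) = rho / (1 - psi^-1)], which holds
   by the choice of [k]. *)
have value : r * shifted i * q + (agg c0 v - c0 * q) = rho / theta * v.
  have aggE : agg c0 v = q * c0 / (1 - psi^-1).
    rewrite aggregatorE -muE /marginal.
    have -> : c0 `^ (1 - psi^-1) = c0 * c0 `^ (- psi^-1).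
      rewrite powRD ?powRr1 ?ltW//.
      by rewrite (gt_eqF c0_gt0) implybT.
    by field; have := aggregator_exponent_lt0; lra.
  have -> : rho / theta * v = rho * (q * shifted i) / (1 - psi^-1).
    rewrite -(checkV_slopeV i j) -/v -theta_exponent.
    by field; lra.
  rewrite aggE /c0 /k; field.
  lra.
lra.
Qed.

(** * The outer iteration and its limit *)

Lemma HTK_invariant k :
  [/\ grid_le (checkU P) (HTK P k), grid_le (HTK P k) (checkV P)
    & subsolution (HTK P k) (HTK P k)].
Proof.
elim: k => [|k [U_le le_V k_sub]].
  split; [by move=> i j | exact: checkU_le_checkV | exact: checkU_subsolution].
have k_lt0 := grid_le_negative le_V checkV_lt0.
have V_super := supersolution_mono le_V checkV_lt0 checkV_supersolution.
have [W [WW W_sol W_ge W_le]] := howard_cvg k_lt0 k_sub V_super.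
have -> : HTK P k.+1 = W by apply: cvg_lim.
split; [exact: grid_le_trans W_ge | by [] |].
apply: subsolution_mono W_ge _ (frozen_subsolution W_sol).
exact: grid_le_negative checkV_lt0.
Qed.

Lemma HTK_negative k : negative (HTK P k).
Proof.
by have [_ le_V _] := HTK_invariant k; exact: grid_le_negative checkV_lt0.
Qed.

(** [Z] is left free: [checkV P] gives existence of the limit, and an arbitrary solution gives
    minimality. *)
Lemma HTK_step k Z : supersolution (HTK P k) Z ->
  [/\ howard (HTK P k) @ \oo --> HTK P k.+1,
      frozen_system (HTK P k) (HTK P k.+1),
      grid_le (HTK P k) (HTK P k.+1) & grid_le (HTK P k.+1) Z].
Proof.
move=> Z_super; have [_ _ k_sub] := HTK_invariant k.
have [W [WW W_sol W_ge W_le]] := howard_cvg (@HTK_negative k) k_sub Z_super.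
by have -> : HTK P k.+1 = W by apply: cvg_lim.
Qed.

Lemma HTK_supersolution k : supersolution (HTK P k) (checkV P).
Proof.
have [_ le_V _] := HTK_invariant k.
exact: supersolution_mono checkV_lt0 checkV_supersolution.
Qed.

(** A solution [W] is a supersolution with itself frozen, hence also with the smaller [HTK P k]
    frozen, so it bounds the next iterate. *)
Lemma HTK_le_solution W k : solution W -> grid_le (HTK P k) W.
Proof.
move=> [W_eq U_le le_V]; have W_lt0 := grid_le_negative le_V checkV_lt0.
elim: k => [|k IH]; first exact: U_le.
suff W_super : supersolution (HTK P k) W by have [] := HTK_step W_super.
by apply: supersolution_mono IH W_lt0 _ => i j; rewrite [leRHS]W_eq.
Qed.

Lemma HTK_cvg : exists2 V, minimal_solution V & HTK P @ \oo --> V.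
Proof.
have HTK_nd k i j : HTK P k i j <= HTK P k.+1 i j.
  by have [_ _ + _] := HTK_step (@HTK_supersolution k); apply.
have HTK_le k i j : HTK P k i j <= checkV P i j.
  by have [_ + _] := HTK_invariant k; apply.
have [V [HV HVij V_ge V_le]] := nondecreasing_mx_cvg HTK_nd HTK_le.
exists V => //; split; last first.
  move=> W W_sol i j; apply: (cvgr_to_le (HVij i j)).
  by apply: nearW => k; exact: HTK_le_solution.
split=> // i j; last exact: (V_ge 0%N).
(* The outer equation mixes iterate [k] in the utility argument with iterate [k.+1] elsewhere; both
   tend to [V]. *)
have VS i' j' : (fun k => HTK P k.+1 i' j') @ \oo --> V i' j'.
  by rewrite (cvg_shiftS (fun k => HTK P k i' j')).
have lhs_cvg : (fun k => rho / theta * HTK P k.+1 i j) @ \oo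
    --> rho / theta * V i j.
  by apply: cvgM => //; exact: cvg_cst.
have rhs_cvg : (fun k => Heps i j (HTK P k i j) (Dplus (HTK P k.+1) i j)
      (Dminus (HTK P k.+1) i j) + coupling (HTK P k.+1) i j) @ \oo
    --> Heps i j (V i j) (Dplus V i j) (Dminus V i j) + coupling V i j.
  apply: cvgD; last exact: cvg_coupling.
  apply: Heps_cvg => //; [|exact: cvg_Dplus|exact: cvg_Dminus].
  exact: le_lt_trans (V_le i j) (checkV_lt0 i j).
suff lhsE : (fun k => rho / theta * HTK P k.+1 i j) =
    (fun k => Heps i j (HTK P k i j) (Dplus (HTK P k.+1) i j)
      (Dminus (HTK P k.+1) i j) + coupling (HTK P k.+1) i j).
  by rewrite lhsE in lhs_cvg; exact: cvg_unique lhs_cvg rhs_cvg.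
apply/funext => k.
by have [_ + _ _] := HTK_step (@HTK_supersolution k); apply.
Qed.

(** A frozen solution is both a sub- and a supersolution, so comparison in both directions gives
    uniqueness. *)
Lemma HTK_frozen_system k V :
  frozen_system (HTK P k) V <-> V = HTK P k.+1.
Proof.
have [_ k_sol _ _] := HTK_step (@HTK_supersolution k).
split=> [V_sol|->//]; have k_lt0 := @HTK_negative k.
apply: grid_le_anti; apply: comparison k_lt0 _ _;
  by [exact: frozen_subsolution | exact: frozen_supersolution].
Qed.

End Howard.

Theorem theorem5p7 (R : realType) (P : params R)
  (gamma_gt1 : 1 < gamma P)
  (psi_gt0 : 0 < psi P) (psi_lt1 : psi P < 1)
  (r_gt0 : 0 < r P) (r_lt_rho : r P < rho P)
  (y1_gt0 : 0 < y1 P) (y1_lt_y2 : y1 P < y2 P)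
  (lambda1_gt0 : 0 < lambda1 P) (lambda2_gt0 : 0 < lambda2 P)
  (xlo_gt : 0 < rho P * xlo P + y1 P)
  (xlo_le0 : xlo P <= 0) (xhi_gt0 : 0 < xhi P)
  (nI_ge1 : (1 <= nI P)%N)
  (theta_gt0 : 0 < theta P) (theta_lt1 : theta P < 1)
  (eps_gt0 : 0 < eps P) (eps_small : r P * xhi P + y2 P < 1 / eps P) :
  [/\ (* every linear system of the inner loop has exactly one solution *)
      forall k n, exists! W, howard_system (HTK P k) (howard (HTK P k) n) W,
      (* every inner loop converges *)
      forall k, cvg (howard (HTK P k) @ \oo),
      (* its limit is the unique solution of the outer system *)
      forall k V, frozen_system (HTK P k) V <-> V = HTK P k.+1
    & (* the outer loop converges to the minimal solution *)
      exists2 V, minimal_solution V & HTK P @ \oo --> V].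
Proof.
split.
- move=> k n; have k_lt0 : negative (HTK P k) by exact: HTK_negative.
  have [W' W'P] : exists W', howard_system (HTK P k) (howard (HTK P k) n) W'.
    exact: howard_system_exists.
  by exists W'; split=> // W''; exact: howard_system_unique.
- move=> k; suff : howard (HTK P k) @ \oo --> HTK P k.+1 by exact: cvgP.
  have V_super : supersolution (HTK P k) (checkV P) by exact: HTK_supersolution.
  by have [] : [/\ howard (HTK P k) @ \oo --> HTK P k.+1,
    frozen_system (HTK P k) (HTK P k.+1), grid_le (HTK P k) (HTK P k.+1)
    & grid_le (HTK P k.+1) (checkV P)] by exact: HTK_step.
- by move=> k V; exact: HTK_frozen_system.
- exact: HTK_cvg.
Qed.
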